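(* Let $\mathbb{I}$ be a nonempty real interval, $n\geqslant1$, and let $\mathsf{F}\colon\mathbb{I}^n\to\mathbb{R}$ be a function satisfying $\mathrm{ran}(\delta_{\mathsf{F}})=\mathrm{ran}(\mathsf{F})$. Assume the Axiom of Choice (not necessary if $\delta_{\mathsf{F}}$ is monotonic). Then the equation $\mathsf{F}=\delta_{\mathsf{F}}\circ\mathsf{G}$, with unknown $\mathsf{G}\colon\mathbb{I}^n\to\mathbb{I}$, has a unique solution if and only if $\delta_{\mathsf{F}}$ is one-to-one. The solution is then given by $\mathsf{G}=\delta_{\mathsf{F}}^{-1}\circ\mathsf{F}$.
   Context: $\delta_{\mathsf{F}}\colon\mathbb{I}\to\mathbb{R}$, $\delta_{\mathsf{F}}(x)=\mathsf{F}(x,\ldots,x)$, is the diagonal section of $\mathsf{F}$; $\mathrm{ran}$ denotes range. Monotonic means either nondecreasing or nonincreasing. When $\delta_{\mathsf{F}}$ is one-to-one, $\delta_{\mathsf{F}}^{-1}\colon\mathrm{ran}(\delta_{\mathsf{F}})\to\mathbb{I}$ denotes its inverse. *)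

(* Defs.v *)
From mathcomp Require Import all_boot all_order all_algebra.
From mathcomp Require Import all_classical all_reals all_analysis.
From Stdlib Require Export ChoiceFacts.

Set Implicit Arguments.
Unset Strict Implicit.
Unset Printing Implicit Defensive.

Import Order.TTheory GRing.Theory Num.Theory.
Local Open Scope classical_set_scope.
Local Open Scope ring_scope.

(* For I : set R, the coercion set_type turns I into the type of its elements,
   so that n.-tuple I is the n-th cartesian power of I and functions into or
   out of I are genuinely total. *)

Definition diagonal_section (R : realType) (I : set R) (n : nat)
    (F : n.-tuple I -> R) : I -> R :=
  fun x => F (nseq_tuple n x).

Definition monotonic (R : realType) (I : set R) (f : I -> R) : Prop :=
  (forall x y : I, val x <= val y -> f x <= f y) \/
  (forall x y : I, val x <= val y -> f y <= f x).

(* Main.v *)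
Require Import Defs.
From mathcomp Require Import all_boot all_order all_algebra.
From mathcomp Require Import all_classical all_reals all_analysis.

Local Open Scope classical_set_scope.
Local Open Scope ring_scope.

(** A solution G of F = f \o G, where f is the diagonal section of F, amounts
    to choosing for every tuple t a preimage of F t under f. If f is injective,
    there is at most one choice, and there is one because the range of f
    contains that of F: the inverse of f selects it ([pinv_unique_factor]).
    Conversely, suppose that f x = f y. On the constant tuple with entries x
    the value of F is f x, so both x and y are admissible there, and any given
    solution can be altered at that single tuple to take either of them. If
    the solution is unique, the two altered solutions coincide and x = y
    ([unique_factor_inj]). *)

Lemma pinv_unique_factor (T X Y : Type) (F : T -> Y) (f : X -> Y)
    (d : Y -> X) :
  range F `<=` range f -> injective f ->
  unique (fun G : T -> X => F = f \o G) ('pinv_d [set: X] f \o F).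
Proof.
move=> ranF f_inj; have fpinvF t : f ('pinv_d [set: X] f (F t)) = F t.
  by apply: pinvK; rewrite inE; apply: ranF; exists t.
split=> [|G FG]; first by apply/funext => t /=.
by apply/funext => t; apply: f_inj; rewrite /= fpinvF FG.
Qed.

(** The section s stands for the diagonal embedding of I into its power. Only
    one value of the solution is changed, so both altered maps remain
    solutions as soon as x and y have the same image. *)
Lemma unique_factor_inj (T : eqType) (X Y : Type) (F : T -> Y) (s : X -> T) :
  (exists! G : T -> X, F = (F \o s) \o G) -> injective (F \o s).
Proof.
move=> [G [FG G_uniq]] x y Fxy.
have alter z : F (s z) = F (s x) ->
    F = (F \o s) \o (fun t => if t == s x then z else G t).
  move=> Fzx; apply/funext => t /=.
  by case: eqP => [->|_]; [rewrite Fzx | rewrite {1}FG].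
have Gx := G_uniq _ (alter x erefl).
have Gy := G_uniq _ (alter y (esym Fxy)).
by have := congr1 (@^~ (s x)) (etrans (esym Gx) Gy); rewrite /= eqxx.
Qed.

(* The inverse of the diagonal section only matters on its range: 'pinv_d is
   the library's inverse, taking the arbitrary values d outside that range. *)
Theorem corollary2p4 (R : realType) (I : set R) (n : nat)
    (F : n.-tuple I -> R)
    (I_itv : is_interval I) (I_neq0 : I !=set0) (n_ge1 : (1 <= n)%N)
    (ranF : range (diagonal_section F) = range F)
    (AC : FunctionalChoice \/ monotonic (diagonal_section F)) :
  ((exists! G : n.-tuple I -> I, F = diagonal_section F \o G) <->
     injective (diagonal_section F)) /\
  (injective (diagonal_section F) ->
   forall d : R -> I,
     unique (fun G : n.-tuple I -> I => F = diagonal_section F \o G)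
            ('pinv_d [set: I] (diagonal_section F) \o F)).
Proof.
have ranFsub : range F `<=` range (diagonal_section F) by rewrite ranF.
split; last by move=> f_inj d; apply: pinv_unique_factor.
split; first exact: (unique_factor_inj _ _ _ F (@nseq_tuple n I)).
case: I_neq0 => x Ix f_inj.
exists ('pinv_(fun=> SigSub (mem_set Ix)) [set: I] (diagonal_section F) \o F).
exact: pinv_unique_factor.
Qed.
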